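(* Consider the network with $M$ CUs, $N$ eRRHs and $K$ CPs under an oblivious stationary randomized (OSR) policy with parameters $b_k^{(n)}$, $r_k$, and put $\zeta_{nk}^l=1-(1-b_k^{(n)})^M$, where $r_k\zeta^l_{nk}>0$ for all $n,k$. Then the average AoI of the eRRHs is $$L_e=\frac{1}{NK}\sum_{n=1}^{N}\sum_{k=1}^{K}\frac{1}{r_k\zeta_{nk}^l}.$$
   Context: Time is slotted, $t=0,1,2,\dots$; $m\in\{1,\dots,M\}$, $n\in\{1,\dots,N\}$, $k\in\{1,\dots,K\}$ index content users (CUs), eRRHs and content providers (CPs). An OSR policy is given by $b_k^{(n)}\in[0,1]$ with $\sum_nb_k^{(n)}\le1$ for each $k$, and $r_1\ge\dots\ge r_K$ in $[0,1]$. In slot $t$, $\beta_{mk}^{(n)}(t)\in\{0,1\}$ indicates that CU $m$ sends a request for CP $k$ to eRRH $n$; $\sum_n\beta_{mk}^{(n)}(t)\le1$ and $\Pr(\beta_{mk}^{(n)}(t)=1)=b_k^{(n)}$. $\gamma_{nk}(t)\in\{0,1\}$ with $\Pr(\gamma_{nk}(t)=1)=r_k$ is the decision of eRRH $n$ to command CP $k$ to send a new packet (effective only if eRRH $n$ received a request for CP $k$). The vectors $(\beta_{mk}^{(n)}(t))_n$ are independent over $m$ and $t$; the $\gamma_{nk}(t)$ are independent over $n,k,t$ and independent of the $\beta$'s. AoI at the eRRHs: $g_{nk}(0)=1$, and $g_{nk}(t+1)=1$ if $\gamma_{nk}(t)\sum_m\beta_{mk}^{(n)}(t)>0$, $g_{nk}(t+1)=g_{nk}(t)+1$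 otherwise. The average AoI of eRRHs is $L_e=\lim_{T\to\infty}\frac1T\sum_{t=1}^T\frac1{NK}\sum_{n=1}^{N}\sum_{k=1}^{K}\mathbb{E}[g_{nk}(t)]$. *)

(* Defs.v *)
From HB Require Import structures.
From mathcomp Require Import all_boot all_order all_algebra finmap.
From mathcomp Require Import all_classical all_reals all_analysis.

Set Implicit Arguments.
Unset Strict Implicit.
Unset Printing Implicit Defensive.

Import Order.TTheory GRing.Theory Num.Theory.
Import numFieldNormedType.Exports.

Local Open Scope classical_set_scope.
Local Open Scope ring_scope.

Section Independence.
Context d (T : measurableType d) (R : realType) (P : probability T R).

Definition sigma_generated d' (S : measurableType d') (I : Type)
    (X : I -> T -> S) : set_system T :=
  <<s \bigcup_i preimage_set_system setT (X i) measurable >>.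

Definition mutually_independent (I : choiceType) (F : I -> set_system T) :=
  forall (J : {fset I}) (A : I -> set T),
    (forall i, i \in J -> F i (A i)) ->
    P (\bigcap_(i in [set` J]) A i) = (\prod_(i <- J) P (A i))%E.

Definition independent_systems (F G : set_system T) :=
  forall A B, F A -> G B -> P (A `&` B) = (P A * P B)%E.

End Independence.

Definition OSR_policy (R : realType) (N K : nat)
    (b : 'I_K -> 'I_N -> R) (r : 'I_K -> R) : Prop :=
  [/\ forall k n, 0 <= b k n <= 1,
      forall k, \sum_(n < N) b k n <= 1,
      forall k, 0 <= r k <= 1 &
      forall j k : 'I_K, (j <= k)%N -> r k <= r j].

(* [beta m n k t] is the indicator that user [m] requests provider [k] at
   eRRH [n] in slot [t]; [gamma n k t] is the command decision of eRRH [n]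
   for provider [k]. *)
Section Network.
Context d (T : measurableType d) (R : realType) (P : probability T R).
Variables M N K : nat.
Variable beta : 'I_M -> 'I_N -> 'I_K -> nat -> {RV P >-> bool}.
Variable gamma : 'I_N -> 'I_K -> nat -> {RV P >-> bool}.

(* No independence between the requests for distinct providers is assumed. *)
Record OSR_network (b : 'I_K -> 'I_N -> R) (r : 'I_K -> R) : Prop := {
  one_request : forall m k t w, (\sum_(n < N) beta m n k t w <= 1)%N ;
  request_prob : forall m n k t,
    P [set w | beta m n k t w = true] = (b k n)%:E ;
  command_prob : forall n k t,
    P [set w | gamma n k t w = true] = (r k)%:E ;
  request_indep : forall k,
    mutually_independent P (fun i : 'I_M * nat =>
      sigma_generated (fun n => beta i.1 n k i.2 : T -> bool)) ;
  command_indep :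
    mutually_independent P (fun i : 'I_N * 'I_K * nat =>
      sigma_generated (fun _ : unit => gamma i.1.1 i.1.2 i.2 : T -> bool)) ;
  command_request_indep :
    independent_systems P
      (sigma_generated (fun i : 'I_N * 'I_K * nat =>
        gamma i.1.1 i.1.2 i.2 : T -> bool))
      (sigma_generated (fun i : 'I_M * 'I_N * 'I_K * nat =>
        beta i.1.1.1 i.1.1.2 i.1.2 i.2 : T -> bool)) }.

(* The booleans are read as 0 and 1. *)
Fixpoint aoi (n : 'I_N) (k : 'I_K) (t : nat) (w : T) : nat :=
  if t is s.+1 then
    if (0 < gamma n k s w * \sum_(m < M) beta m n k s w)%N then 1%N
    else (aoi n k s w).+1
  else 1%N.

Definition mean_aoi (t : nat) : \bar R :=
  (((N * K)%:R^-1)%:E *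
     \sum_(n < N) \sum_(k < K) 'E_P[fun w => (aoi n k t w)%:R])%E.

Definition time_mean_aoi (H : nat) : \bar R :=
  ((H%:R^-1)%:E * \sum_(1 <= t < H.+1) mean_aoi t)%E.

Definition average_aoi : \bar R := limn time_mean_aoi.

End Network.

(* Probability that some of the [M] users requests provider [k] at eRRH [n]. *)
Definition zeta (R : realType) (M N K : nat) (b : 'I_K -> 'I_N -> R)
    (n : 'I_N) (k : 'I_K) : R := 1 - (1 - b k n) ^+ M.

(* Main.v *)
(* The age of pair (n, k) at time t is one plus the number of j in 1..t such
   that the j slots preceding t are all unsuccessful, so its expectation is a
   sum of the probabilities of such runs. Slot successes are independent with
   probability p = r_k * zeta, hence E[g(t)] = sum_(j <= t) (1 - p)^j, which
   tends to 1 / p; Cesaro's lemma transfers the limit to the time averages. *)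
Require Import Defs.
From mathcomp Require Import all_boot all_order all_algebra finmap.
From mathcomp Require Import all_classical all_reals all_analysis.
From mathcomp Require Import measurable_realfun ring.

Import Order.TTheory GRing.Theory Num.Theory.
Import numFieldNormedType.Exports.

Local Open Scope classical_set_scope.
Local Open Scope ring_scope.

(** Passes from finite sets to duplicate-free lists, where intersections over mapped or paired
    indices can be computed, for events of common probability [c]. *)
Lemma mutually_independent_seq {d} {T : measurableType d} {R : realType}
    {P : probability T R} {I : choiceType} {F : I -> set_system T}
    {A : I -> set T} (c : R) {s : seq I} :
  mutually_independent P F -> uniq s ->
  (forall i, i \in s -> F i (A i)) -> (forall i, i \in s -> P (A i) = c%:E) ->
  P (\big[setI/setT]_(i <- s) A i) = (c ^+ size s)%:E.
Proof.
move=> Find us FA PA.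
have perm_s : perm_eq [fset i in s]%fset s.
  by apply: uniq_perm => // i; rewrite !inE.
rewrite -(perm_big _ perm_s) -bigcap_fset Find//; last first.
  by move=> i; rewrite !inE; exact: FA.
rewrite (perm_big _ perm_s) big_seq (eq_bigr (fun=> c%:E)) -?big_seq//.
by rewrite prodEFin big_const_seq count_predT iter_mulr_1.
Qed.

(** Independence survives complementation. It is used twice: to pass from no request to some
    request, and from successful slots to unsuccessful ones. *)
Lemma probability_bigsetIC {d} {T : measurableType d} {R : realType}
    {P : probability T R} {I : eqType} {E : I -> set T} {p : R} :
  (forall i, measurable (E i)) ->
  (forall s, uniq s -> P (\big[setI/setT]_(i <- s) E i) = (p ^+ size s)%:E) ->
  forall s, uniq s ->
    P (\big[setI/setT]_(i <- s) ~` E i) = ((1 - p) ^+ size s)%:E.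
Proof.
move=> mE PE s us.
(* Complementing one event at a time yields mixed intersections: [s1] lists the events kept, [s]
   those complemented. The induction needs all [s1], since the subtracted term moves [x] from [s] to
   [s1]. *)
suff H s1 : uniq (s1 ++ s) ->
    P (\big[setI/setT]_(i <- s1) E i `&` \big[setI/setT]_(i <- s) ~` E i) =
    (p ^+ size s1 * (1 - p) ^+ size s)%:E.
  by have := H [::] us; rewrite big_nil setTI mul1r.
elim: s s1 {us} => [|x s IH] s1.
  by rewrite cats0 big_nil setIT mulr1; exact: PE.
move=> us; have us1 : uniq (s1 ++ s).
  by apply: subseq_uniq us; rewrite cat_subseq// subseq_cons.
have us2 : uniq ((x :: s1) ++ s) by rewrite -cat1s uniq_catCA in us.
have mI r : measurable (\big[setI/setT]_(i <- r) E i).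
  exact: bigsetI_measurable.
have mIC r : measurable (\big[setI/setT]_(i <- r) ~` E i).
  by apply: bigsetI_measurable => i _; exact: measurableC.
have PD A B : measurable A -> measurable B ->
    P (A `\` B) = (P A - P (A `&` B))%E.
  by move=> mA mB; rewrite measureD// (le_lt_trans (probability_le1 _ _)) ?ltry.
rewrite big_cons (setIC (~` _)) setIA -setDE PD//; last exact: measurableI.
rewrite IH// (setIC _ (E x)) setIA -(big_cons _ _ x s1 xpredT) IH//= -EFinB.
by rewrite !exprS; congr _%:E; ring.
Qed.

Lemma sigma_generated_preimage {d d'} {T : measurableType d}
    {S : measurableType d'} {I : Type} (X : I -> T -> S) i (A : set S) :
  measurable A -> sigma_generated X (X i @^-1` A).
Proof.
by move=> mA; apply: sub_sigma_algebra; exists i => //; exists A => //;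
  rewrite setTI.
Qed.

Section sigma_generated_closure.
Context {d d'} {T : measurableType d} {S : measurableType d'} {I : Type}.
Variable X : I -> T -> S.

Lemma sigma_generatedC A : sigma_generated X A -> sigma_generated X (~` A).
Proof. exact: (@measurableC _ (g_sigma_algebraType _)). Qed.

Lemma sigma_generated_bigsetI (J : Type) (s : seq J) (A : J -> set T) :
  (forall j, sigma_generated X (A j)) ->
  sigma_generated X (\big[setI/setT]_(j <- s) A j).
Proof.
move=> XA; apply: (@bigsetI_measurable _ (g_sigma_algebraType _)) => j _.
exact: XA.
Qed.

End sigma_generated_closure.

Section network.
Context {d : measure_display} {T : measurableType d} {R : realType}.
Context {P : probability T R} {M N K : nat}.
Context {b : 'I_K -> 'I_N -> R} {r : 'I_K -> R}.
Context {beta : 'I_M -> 'I_N -> 'I_K -> nat -> {RV P >-> bool}}.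
Context {gamma : 'I_N -> 'I_K -> nat -> {RV P >-> bool}}.
Variables (n : 'I_N) (k : 'I_K).

Definition commanded (s : nat) : set T := gamma n k s @^-1` [set true].

(** Absence of requests comes first because it is an intersection of independent events, one per
    user; some request is its complement. *)
Definition unrequested (s : nat) : set T :=
  \big[setI/setT]_(m <- enum 'I_M) (beta m n k s @^-1` [set false]).

Definition refreshed (s : nat) : set T := commanded s `&` ~` unrequested s.

Lemma refreshedP s w :
  refreshed s w <-> (0 < gamma n k s w * \sum_(m < M) beta m n k s w)%N.
Proof.
rewrite /refreshed /commanded /unrequested -bigcap_seq muln_gt0 lt0b /=.
split=> [[-> unreq]|/andP[-> req]]; last first.
  split=> // unreq; move: req; rewrite big1// => m _.
  by rewrite (unreq m) //= mem_enum.
rewrite /= lt0n; apply/eqP => /eqP; rewrite sum_nat_eq0 => /forallP req0.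
by apply: unreq => m _ /=; have := req0 m; case: (beta m n k s w).
Qed.

Lemma measurable_commanded s : measurable (commanded s).
Proof. by rewrite -[commanded s]setTI; exact: measurable_funP. Qed.

Lemma measurable_unrequested s : measurable (unrequested s).
Proof.
apply: bigsetI_measurable => m _.
by rewrite -[_ @^-1` _]setTI; exact: measurable_funP.
Qed.

Lemma measurable_refreshed s : measurable (refreshed s).
Proof.
by apply: measurableI; [exact: measurable_commanded|
  apply: measurableC; exact: measurable_unrequested].
Qed.

(** The initial age 1 acts as a refresh just before slot 0, so runs are cut off at length [t]. *)
Lemma aoiE t w :
  (aoi beta gamma n k t w)%:R =
  \sum_(j < t.+1) \1_(\big[setI/setT]_(t - j <= s < t) ~` refreshed s) w :> R.
Proof.
elim: t => [|t IH].
  by rewrite big_ord1 subn0 big_geq// indicT.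
rewrite big_ord_recl subn0 big_geq// indicT.
(* Every nonempty run preceding time [t.+1] contains slot [t]: the indicator of failure at [t]
   factors out and leaves the age at time [t]. *)
under eq_bigr => j _.
  rewrite lift0 subSS big_nat_recr ?leq_subr// indicI.
  over.
rewrite -mulr_suml -IH /=; case: ifPn => [/refreshedP ref|/negP ref].
  by rewrite indicE memNset ?mulr0 ?addr0//= => /(_ ref).
rewrite indicE mem_set; last by move=> /refreshedP.
by rewrite mulr1 -natr1 addrC.
Qed.

Hypothesis hnetwork : OSR_network beta gamma b r.

Lemma probability_commanded s : uniq s ->
  P (\big[setI/setT]_(i <- s) commanded i) = (r k ^+ size s)%:E.
Proof.
move=> us.
pose A (i : 'I_N * 'I_K * nat) := gamma i.1.1 i.1.2 i.2 @^-1` [set true].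
have -> : \big[setI/setT]_(i <- s) commanded i =
    \big[setI/setT]_(i <- [seq (n, k, t) | t <- s]) A i by rewrite big_map.
rewrite (mutually_independent_seq (r k) (command_indep hnetwork)).
- by rewrite size_map.
- by rewrite map_inj_uniq// => ? ? [].
- move=> _ /mapP[t _ ->]; exact: (sigma_generated_preimage _ tt).
- move=> _ /mapP[t _ ->]; exact: (command_prob hnetwork).
Qed.

Lemma probability_unrequested s : uniq s ->
  P (\big[setI/setT]_(i <- s) unrequested i) =
  (((1 - b k n) ^+ M) ^+ size s)%:E.
Proof.
move=> us.
pose A (i : 'I_M * nat) := beta i.1 n k i.2 @^-1` [set false].
(* The double intersection is flattened to pairs of a user and a slot, the index type of
   [request_indep]; each slot contributes [M] pairs. *)
have -> : \big[setI/setT]_(i <- s) unrequested i =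
    \big[setI/setT]_(i <- [seq (m, t) | m <- enum 'I_M, t <- s]) A i.
  by rewrite big_allpairs exchange_big.
have indep := request_indep hnetwork.
rewrite (mutually_independent_seq (1 - b k n) (indep k)).
- by rewrite size_allpairs size_enum_ord exprM.
- by apply: allpairs_uniq; rewrite ?enum_uniq// => -[? ?] [? ?] _ _.
- move=> [m t] _; exact: (sigma_generated_preimage _ n).
- move=> [m t] _; rewrite EFinB -(request_prob hnetwork m n k t).
  have mreq : measurable (beta m n k t @^-1` [set true]).
    by rewrite -[_ @^-1` _]setTI; exact: measurable_funP.
  rewrite -(probability_setC P mreq); congr (P _).
  by apply/seteqP; split=> w; rewrite /A /=; case: (beta m n k t w).
Qed.

Lemma probability_requested s : uniq s ->
  P (\big[setI/setT]_(i <- s) ~` unrequested i) =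
  (zeta M b n k ^+ size s)%:E.
Proof.
apply: probability_bigsetIC probability_unrequested _.
exact: measurable_unrequested.
Qed.

(** The intersection splits into a command part and a request part, which lie in independent
    sigma-algebras, so their probabilities multiply. *)
Lemma probability_refreshed s : uniq s ->
  P (\big[setI/setT]_(i <- s) refreshed i) =
  ((r k * zeta M b n k) ^+ size s)%:E.
Proof.
move=> us; rewrite big_split (command_request_indep hnetwork).
- by rewrite probability_commanded// probability_requested// -EFinM exprMn.
- apply: sigma_generated_bigsetI => t.
  exact: (sigma_generated_preimage _ (n, k, t)).
- apply: sigma_generated_bigsetI => t.
  apply: sigma_generatedC; apply: sigma_generated_bigsetI => m.
  exact: (sigma_generated_preimage _ (m, n, k, t)).
Qed.

Lemma expectation_aoi t :
  'E_P[fun w => (aoi beta gamma n k t w)%:R]%E =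
  (series (geometric 1 (1 - r k * zeta M b n k)) t.+1)%:E.
Proof.
rewrite unlock; under eq_integral => w _ do rewrite aoiE -sumEFin.
have mrun i : measurable (\big[setI/setT]_(t - i <= s < t) ~` refreshed s).
  by apply: bigsetI_measurable => s _; apply: measurableC;
     exact: measurable_refreshed.
rewrite ge0_integral_sum//; last first.
  by move=> i; apply/measurable_EFinP; exact: measurable_indic.
rewrite seriesEord/= -sumEFin; apply: eq_bigr => i _.
rewrite integral_indic// setIT.
(* The run has exactly [i] slots because [i <= t], which gives the geometric term of exponent
   [i]. *)
transitivity ((1 - r k * zeta M b n k) ^+ size (index_iota (t - i) t))%:E.
  exact: (probability_bigsetIC measurable_refreshed probability_refreshed _
    (iota_uniq _ _)).
by rewrite size_iota subKn ?mul1r// -ltnS.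
Qed.

End network.

Theorem proposition5 (d : measure_display) (T : measurableType d)
    (R : realType) (P : probability T R) (M N K : nat)
    (hM : (0 < M)%N) (hN : (0 < N)%N) (hK : (0 < K)%N)
    (b : 'I_K -> 'I_N -> R) (r : 'I_K -> R)
    (beta : 'I_M -> 'I_N -> 'I_K -> nat -> {RV P >-> bool})
    (gamma : 'I_N -> 'I_K -> nat -> {RV P >-> bool})
    (hpolicy : OSR_policy b r)
    (hnetwork : OSR_network beta gamma b r)
    (hpos : forall (n : 'I_N) (k : 'I_K), 0 < r k * zeta M b n k) :
  cvgn (time_mean_aoi beta gamma) /\
  average_aoi beta gamma =
    ((N * K)%:R^-1 *
       \sum_(n < N) \sum_(k < K) (r k * zeta M b n k)^-1)%:E.
Proof.
set L := _ * _.
have [b01 _ r01 _] := hpolicy.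
pose p n k := r k * zeta M b n k.
(* With [hpos], this puts the ratio [1 - p n k] in [0, 1), where the geometric series converges. *)
have p_le1 n k : p n k <= 1.
  have /andP[r_ge0 r_le1] := r01 k; have /andP[b_ge0 b_le1] := b01 k n.
  have z_le1 : zeta M b n k <= 1.
    by rewrite /zeta lerBlDr lerDl exprn_ge0// subr_ge0.
  have z_ge0 : 0 <= zeta M b n k.
    by rewrite /zeta subr_ge0 exprn_ile1 ?subr_ge0// lerBlDr lerDl.
  exact: mulr_ile1.
pose u t := (N * K)%:R^-1 *
  \sum_(n < N) \sum_(k < K) series (geometric 1 (1 - p n k)) t.+1.
have mean_u t : mean_aoi beta gamma t = (u t)%:E.
  rewrite /mean_aoi /u EFinM -sumEFin; congr (_ * _)%E.
  apply: eq_bigr => n _; rewrite -sumEFin; apply: eq_bigr => k _.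
  exact: expectation_aoi.
have u_cvg : u @ \oo --> L.
  apply: cvgMl_tmp; apply: cvg_big => [|n _]; first exact: add_continuous.
  apply: cvg_big => [|k _]; first exact: add_continuous.
  rewrite cvg_shiftS.
  have -> : (r k * zeta M b n k)^-1 = 1 / (1 - (1 - p n k)).
    by rewrite subKr div1r.
  apply: cvg_geometric_series; rewrite ger0_norm ?subr_ge0//.
  by rewrite ltrBlDr ltrDl; exact: hpos.
have cvgL : time_mean_aoi beta gamma @ \oo --> L%:E.
  (* [arithmetic_mean] at [H] averages [H.+1] terms, so the horizon is shifted by one, which also
     drops horizon 0, where the inverse is 0 by convention. Since the time average starts at slot 1,
     [u] is shifted as well. *)
  rewrite -cvg_shiftS.
  have -> : [sequence time_mean_aoi beta gamma H.+1]_H =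
      EFin \o arithmetic_mean (fun t => u t.+1).
    apply/funext => H /=; rewrite /time_mean_aoi EFinM; congr (_ * _)%E.
    rewrite /series/= -sumEFin big_add1/=; apply: eq_bigr => t _.
    exact: mean_u.
  apply: cvg_EFin; first exact: nearW.
  by apply: cesaro; rewrite cvg_shiftS.
by split; [apply/cvg_ex; exists L%:E|exact/cvg_lim].
Qed.
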